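(* Let $D\subset\mathbb{R}$ be a Lebesgue measurable set of positive measure, and for $i=1,\ldots,n$ let $f_i:D\to\mathbb{R}$ be an a.e. $T_i$-periodic function that is measurable and not a.e. constant on $D$. Suppose that all sums of the $f_i$'s in which the number of summands is less than $n$ are not a.e. constant, i.e. for every nonempty proper subset $I\subsetneq\{1,\ldots,n\}$ the function $\sum_{i\in I}f_i$ is not a.e. constant on $D$. Then the sum $f_1+\cdots+f_n$ is a.e. periodic if and only if the periods $T_1,\ldots,T_n$ are (pairwise) commensurable.
   Context: A set $D\subset\mathbb{R}$ is $T$-invariant if $D+T=D$. A function $f$ with domain $D$ is called a.e. periodic with period $T$ (a.e. $T$-periodic), where $T>0$, if $D$ is $T$-invariant (exactly) and $f(x+T)=f(x)$ for almost every $x\in D$; it is a.e. periodic if this holds for some $T>0$. The function $f$ is called not a.e. constant if for every $c$ the set $\{x\in D : f(x)\neq c\}$ has positive Lebesgue measure. Two nonzero real numbers are commensurable if their ratio is rational. *)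

(* Defs.v *)
From HB Require Import structures.
From mathcomp Require Import all_boot all_order all_algebra.
From mathcomp Require Import all_classical all_reals all_analysis.

Set Implicit Arguments.
Unset Strict Implicit.
Unset Printing Implicit Defensive.

Import Order.TTheory GRing.Theory Num.Theory.
Import numFieldNormedType.Exports.

Local Open Scope classical_set_scope.
Local Open Scope ring_scope.

(* The carrier R with the sigma-algebra of Lebesgue measurable sets, i.e. the
   Caratheodory-measurable sets for the outer measure generated by the length
   of intervals; the plain measurable structure of R is the Borel one.  This is
   the domain of [completed_lebesgue_measure]. *)
Notation lebesgueType R := (caratheodory_type (@wlength R idfun)^*%mu).

Definition lebesgue_measurable (R : realType) (D : set R) : Prop :=
  measurable (D : set (lebesgueType R)).

(* A function with domain D is represented by a total function R -> R, of which
   only the values on D matter. *)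
Definition lebesgue_measurable_fun (R : realType) (D : set R) (f : R -> R) :
    Prop :=
  measurable_fun (D : set (lebesgueType R))
    (f : lebesgueType R -> measurableTypeR R).

Definition translation_invariant (R : realType) (D : set R) (T : R) : Prop :=
  [set x + T | x in D] = D.

Definition ae_periodic_with (R : realType) (D : set R) (f : R -> R) (T : R) :
    Prop :=
  [/\ 0 < T, translation_invariant D T &
      {ae (@completed_lebesgue_measure R), forall x, D x -> f (x + T) = f x}].

Definition ae_periodic (R : realType) (D : set R) (f : R -> R) : Prop :=
  exists T : R, ae_periodic_with D f T.

Definition not_ae_constant (R : realType) (D : set R) (f : R -> R) : Prop :=
  forall c : R,
    (0 < completed_lebesgue_measure [set x | D x /\ f x <> c])%E.

Definition commensurable (R : realType) (x y : R) : Prop :=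
  [/\ x != 0, y != 0 & exists q : rat, x / y = ratr q].

(* Main.v *)
(* The functions are extended by 0 outside D, which keeps their a.e. periods
   because D is exactly invariant.  By Lebesgue's density theorem a measurable
   function with a dense group of a.e. periods is a.e. constant, since none of
   its level sets can have density 1 at one point and 0 at another.  A subgroup
   of R containing two incommensurable numbers is dense, so two incommensurable
   periods force constancy; and so do a period a and an a.e. constant
   difference g(x + b) - g(x) with b incommensurable with a.

   If the sum has period T and T_i is not commensurable with T_j, then one of
   them, say T_i, is not commensurable with T.  Let g be the sum of the f_k with
   T_k commensurable with T_i; it has a period P commensurable with T_i.
   Writing g as the total sum minus the remaining f_k, the successive differences
   of g along T and the remaining T_k vanish.  All these steps are
   incommensurable with P, so removing them one at a time shows that g is a.e.
   constant, contrary to the hypothesis on partial sums. *)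
Require Import Defs.
From mathcomp Require Import all_boot all_order all_algebra.
From mathcomp Require Import all_classical all_reals all_analysis.
From mathcomp Require Import measurable_realfun ring lra.

Import Order.TTheory GRing.Theory Num.Theory.
Import numFieldNormedType.Exports.

Local Open Scope classical_set_scope.
Local Open Scope ring_scope.

Set Implicit Arguments.
Unset Strict Implicit.
Unset Printing Implicit Defensive.

(** * Null sets, Lebesgue measurability and translations *)

Section translation.
Context {R : realType}.
Local Notation mu := (@lebesgue_measure R).
Implicit Types (A E N : set R) (t : R).

#[global] Instance ae_lebesgue_filter : Filter (almost_everywhere mu) :=
  ae_filter_ringOfSetsType mu.

#[global] Instance nbhs_ae_lebesgue_filter :
  Filter (nbhs (almost_everywhere mu)) := ae_filter_ringOfSetsType mu.

(** Both measures have the sets of outer measure zero as null sets. Everything below can therefore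
    be done with [mu] on Borel sets. *)
Lemma ae_completedE (P : set R) :
  {ae @completed_lebesgue_measure R, forall x, P x} <-> {ae mu, forall x, P x}.
Proof.
split=> [[A [mA A0 PA]]|/negligible_outer_measure P0].
  by apply: (@negligibleS _ _ _ mu A) => //; exact/negligible_outer_measure.
exists (~` P); split=> //.
rewrite -completed_caratheodory_measurable; apply: sub_sigma_algebra.
exists set0; first exact: measurable0.
by exists (~` P); [exact/negligible_outer_measure|rewrite set0U].
Qed.

Lemma measurable_shift t :
  measurable_fun setT (fun x : measurableTypeR R => x + t : measurableTypeR R).
Proof. exact: measurable_funD. Qed.

(** By uniqueness of Lebesgue measure: the pushforward of [mu] along the translation gives half-open
    intervals their length. *)
Lemma lebesgue_measure_shift A t : measurable A ->
  mu ((fun x => x + t) @^-1` A) = mu A.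
Proof.
move=> mA; apply/esym.
apply: (@lebesgue_measure_unique R
  (measure_function_pushforward__canonical__measure_function_Measure mu
     (measurable_shift t))) => // _ [[a b] _ <-] /=.
rewrite /pushforward (_ : _ @^-1` _ = [set` `]a - t, b - t]]).
  by rewrite !lebesgue_measure_itv/= !lte_fin ltrD2r -!EFinD opprB addrA subrK.
by apply/seteqP; split=> x /=; rewrite !in_itv/= ltrBlDr lerBrDr.
Qed.

Lemma negligible_shift N t :
  mu.-negligible N -> mu.-negligible ((fun x => x + t) @^-1` N).
Proof.
move=> [A [mA A0 NA]]; exists ((fun x => x + t) @^-1` A); split.
- by rewrite -[X in measurable X]setTI; exact: measurable_shift.
- by rewrite lebesgue_measure_shift.
- exact: preimage_subset.
Qed.

Lemma ae_shift (P : set R) t :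
  {ae mu, forall x, P x} -> {ae mu, forall x, P (x + t)}.
Proof. exact: (@negligible_shift (~` P)). Qed.

(** The Caratheodory sigma-algebra is the completion of the Borel one, so its members are Borel sets
    altered on a null set. *)
Lemma lebesgue_measurableP E : lebesgue_measurable E <->
  exists2 A, measurable (A : set (measurableTypeR R)) &
    {ae mu, forall x, E x <-> A x}.
Proof.
rewrite /lebesgue_measurable -completed_caratheodory_measurable.
rewrite g_sigma_completed_algebra_genE.
split=> [[A mA [N N0 <-]]|[A mA [N [mN N0 EAN]]]].
  exists A => //; apply: negligibleS N0 => x /=.
  by apply: contra_notP => Nx; split=> [[]|] //; left.
have EA x : ~ N x -> (E x <-> A x).
  by move=> Nx; apply: contrapT => EAx; apply: Nx; exact: EAN.
exists (A `\` N); first exact: measurableD.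
exists (E `&` N); first by exists N; split=> //; exact: subIsetr.
apply/seteqP; split=> [x [[Ax /EA[_]]|[]]|x Ex] //; first exact.
have [Nx|Nx] := pselect (N x); first by right.
by left; split=> //; exact/EA.
Qed.

Lemma measurable_lebesgue_shift t :
  measurable_fun setT (fun x : lebesgueType R => x + t : lebesgueType R).
Proof.
move=> _ E /lebesgue_measurableP[A mA EA]; rewrite setTI.
apply/lebesgue_measurableP; exists ((fun x => x + t) @^-1` A).
  by rewrite -[X in measurable X]setTI; exact: measurable_shift.
exact: (@ae_shift (fun x => E x <-> A x)).
Qed.

End translation.

(** * Subgroups of the real line *)

Section subgroup.
Context {R : realType} (G : set R).
Hypothesis GB : forall x y, G x -> G y -> G (x - y).

Lemma subgroup_mulrz x (k : int) : G x -> G (x *~ k).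
Proof.
move=> Gx; have G0 : G 0 by rewrite -(subrr x); exact: GB.
have Gn n : G (x *+ n).
  elim: n => [|n IH]; first by rewrite mulr0n.
  by rewrite mulrS -[x *+ n]opprK; apply: GB; rewrite // -sub0r; exact: GB.
by case: k => n; [exact: Gn | rewrite NegzE mulrNz -sub0r; exact: GB G0 (Gn _)].
Qed.

Lemma subgroup_floor (g x : R) : 0 < g ->
  0 <= x - g *~ Num.floor (x / g) < g.
Proof.
move=> g0; have := floor_itv (x / g); move: (Num.floor (x / g)) => k.
rewrite intrD => /andP[le lt].
have {}le : k%:~R * g <= x by rewrite -ler_pdivlMr.
have {}lt : x < (k%:~R + 1) * g by rewrite -ltr_pdivrMr.
by rewrite subr_ge0 ltrBlDl -mulrzl le /= -{2}[g]mul1r -mulrDl.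
Qed.

Lemma subgroup_dense a b x r : a != 0 -> b != 0 -> ~ commensurable a b ->
  G a -> G b -> 0 < r -> exists2 g, G g & `|x - g| < r.
Proof.
move=> a0 b0 nab Ga Gb r0.
have G0 : G 0 by rewrite -(subrr a); exact: GB.
(* Without arbitrarily small positive elements, [G] is generated by its least
   positive element. *)
have [g Gg /andP[g0 gr]] : exists2 g, G g & 0 < g < r.
  apply: contrapT => small; apply: nab.
  pose S := [set g | G g /\ 0 < g].
  have Sr g : S g -> r <= g.
    move=> [Gg g0]; rewrite leNgt; apply/negP => gr; apply: small.
    by exists g; rewrite ?g0.
  have infS : has_inf S.
    split; last by exists r.
    have [a_gt0|a_lt0|a_eq0] := ltgtP 0 a; last by rewrite a_eq0 eqxx in a0.
    - by exists a.
    - by exists (- a); split; rewrite ?oppr_gt0// -sub0r; exact: GB.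
  (* Distinct elements of [S] are at least [r] apart, so an element within [r] of the infimum is the
     least one. *)
  have [g [Gg g0] ginf] := inf_adherent r0 infS.
  have gmin y : S y -> g <= y.
    move=> [Gy y0]; rewrite leNgt; apply/negP => yg.
    have : r <= g - y by apply: Sr; split; [exact: GB | rewrite subr_gt0].
    have : inf S <= y by apply: ge_inf => //; exact: infS.2.
    lra.
  have gen y : G y -> exists k : int, y = g *~ k.
    move=> Gy; have /andP[k0 kg] := subgroup_floor y g0.
    exists (Num.floor (y / g)); move: k0 kg.
    set k := Num.floor _ => k0 kg.
    have Gk : G (y - g *~ k) by apply: GB => //; exact: subgroup_mulrz.
    apply/eqP; rewrite -subr_eq0 eq_le k0 andbT leNgt; apply/negP => k_gt0.
    by have := gmin _ (conj Gk k_gt0); rewrite leNgt kg.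
  have [[k ak] [l bl]] := (gen _ Ga, gen _ Gb).
  split=> //; exists (k%:~R / l%:~R).
  rewrite (fmorph_div (@ratr R)) !rmorph_int ak bl.
  rewrite -[g *~ k]mulrzr -[g *~ l]mulrzr -mulf_div divff ?mul1r//.
  by rewrite gt_eqF.
have /andP[k0 kr] := subgroup_floor x g0.
exists (g *~ Num.floor (x / g)); first exact: subgroup_mulrz.
by rewrite ger0_norm// (lt_trans kr).
Qed.

End subgroup.

(** * The group of almost everywhere periods *)

Section ae_period.
Context {R : realType} {U : Type}.
Local Notation mu := (@lebesgue_measure R).
Implicit Types f : R -> U.

(** The codomain [U] is arbitrary so that a set, as a map into [Prop], has a.e. periods too. *)
Definition ae_period f : set R :=
  [set t | {ae mu, forall x, f (x + t) = f x}].

Lemma ae_periodB f s t : ae_period f s -> ae_period f t -> ae_period f (s - t).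
Proof.
move=> fs /(@ae_shift _ _ (- t)) ft.
have := @ae_shift _ _ (- t) fs; apply: filterS2 ft => x.
by rewrite subrK addrAC -addrA => -> ->.
Qed.

End ae_period.

(** * Lebesgue density and dense groups of periods *)

Section ergodicity.
Context {R : realType}.
Local Notation mu := (@lebesgue_measure R).

(** The tolerance 1/4 is fine enough to compare a ball with one of twice its radius. *)
Definition near_density (A : set R) (x : R) := exists2 e : R, 0 < e &
  forall r : R, 0 < r < e ->
    `|\1_A x - fine (mu (A `&` ball x r)) / (r *+ 2)| < 4^-1.

Lemma measure_ball_fin_num (A : set R) (x r : R) : measurable A -> 0 <= r ->
  mu (A `&` ball x r) \is a fin_num.
Proof.
move=> mA r0; rewrite ge0_fin_numE//.
apply: (@le_lt_trans _ _ (mu (ball x r))).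
  rewrite le_measure ?inE//; last exact: measurable_ball.
  by apply: measurableI => //; exact: measurable_ball.
by rewrite lebesgue_measure_ball// ltry.
Qed.

Lemma ae_near_density (A : set R) : measurable A ->
  {ae mu, forall x, near_density A x}.
Proof.
move=> mA; apply: filterS (lebesgue_density mA) => x Ax.
have /fine_cvgP[_ /cvgrPdist_lt /(_ 4^-1)] := Ax.
case=> [|e /= e0 He]; first by rewrite invr_gt0.
exists e => // r /andP[r0 re].
have := He r; rewrite /= sub0r normrN gtr0_norm// => /(_ re r0).
rewrite lebesgue_measure_ball ?ltW// inver mulrn_eq0/= gt_eqF//.
by rewrite -(fineK (measure_ball_fin_num x mA (ltW r0))) -EFinM.
Qed.

(* A translation by a period in the dense group moves [ball x r] into
   [ball y (r *+ 2)], so [A] cannot have density [1] at [x] and [0] at [y]. *)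
Lemma dense_ae_period_density (A : set R) (x y : R) : measurable A ->
  (forall z r : R, 0 < r -> exists2 g, ae_period A g & `|z - g| < r) ->
  near_density A x -> near_density A y -> A x -> A y.
Proof.
move=> mA dense [e e0 He] [d d0 Hd] Ax; apply: contrapT => Ay.
have le_ball (r : R) : 0 < r ->
    (mu (A `&` ball x r) <= mu (A `&` ball y (r *+ 2)))%E.
  move=> r0; have [g Ag gr] := dense (x - y) r r0.
  rewrite -(lebesgue_measure_shift g (measurableI _ _ mA (measurable_ball x r))).
  set B := _ @^-1` _; have mB : measurable B.
    rewrite -[X in measurable X]setTI; apply: measurable_shift => //.
    by apply: measurableI => //; exact: measurable_ball.
  have [N [mN N0 AN]] := Ag.
  have BN : B `<=` (A `&` ball y (r *+ 2)) `|` N.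
    move=> z [Az xz]; have [Nz|Nz] := pselect (N z); [by right|left].
    split.
      have : A (z + g) = A z by apply: contrapT => zN; apply: Nz; exact: AN.
      by move=> <-.
    move: xz gr; rewrite /ball/= !ltr_norml => /andP[? ?] /andP[? ?].
    by apply/andP; split; rewrite mulr2n; lra.
  have mAy : measurable (A `&` ball y (r *+ 2)).
    by apply: measurableI => //; exact: measurable_ball.
  apply: (@le_trans _ _ (mu ((A `&` ball y (r *+ 2)) `|` N))).
    by apply: le_measure => //; rewrite inE//; exact: measurableU.
  have := @measureU2 _ _ _ mu _ _ mAy mN.
  by rewrite [X in (_ <= _ + X)%E]N0 adde0.
(* Small enough that [r] is below [e] and [r *+ 2] is below [d]. *)
pose r : R := Num.min e d / 4.
have m0 : 0 < Num.min e d by rewrite lt_min e0 d0.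
have r0 : 0 < r by rewrite divr_gt0.
have [me md] : Num.min e d <= e /\ Num.min e d <= d
  by rewrite !ge_min !lexx orbT.
have re : r < e by rewrite /r; lra.
have r2d : r *+ 2 < d by rewrite /r mulr2n; lra.
have r20 : 0 < r *+ 2 by rewrite mulrn_wgt0.
have := He r; rewrite r0 re => /(_ isT).
have := Hd (r *+ 2); rewrite r20 r2d => /(_ isT).
have := le_ball r r0.
rewrite -(fineK (measure_ball_fin_num x mA (ltW r0))).
rewrite -(fineK (measure_ball_fin_num y mA (ltW r20))) lee_fin.
rewrite !indicE (mem_set Ax) (memNset Ay) /= mulr0n.
move: (fine _) (fine _) => b a ab.
rewrite !ltr_norml => /andP[yb _] /andP[_ xa].
(* The densities at [y] and [x] give [b < r] and [r < a], against [a <= b]. *)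
have {}yb : b / (r *+ 2 *+ 2) < 4^-1 by move: yb; rewrite sub0r ltrN2.
have {}xa : 2^-1 < a / (r *+ 2).
  by move: xa; move: (a / _) => z; lra.
move: yb xa; rewrite ltr_pdivrMr ?mulrn_wgt0// ltr_pdivlMr ?mulrn_wgt0//.
rewrite (mulr2n (r *+ 2)) (mulr2n r) => ? ?.
lra.
Qed.

End ergodicity.

(** * Rigidity under two incommensurable translations *)

Section sum_of_periodic.
Context {R : realType}.
Local Notation mu := (@lebesgue_measure R).
Implicit Types (f g : R -> R) (a b c t : R).

Lemma ae_exists (P : R -> Prop) : {ae mu, forall x, P x} -> exists x, P x.
Proof.
move=> [N [mN N0 PN]]; apply: contrapT => nP.
have : mu setT = 0%E.
  rewrite -[RHS]N0; congr mu; apply/seteqP; split=> // x _.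
  by apply: PN => Px; apply: nP; exists x.
by rewrite -set_itvNyy lebesgue_measure_itv.
Qed.

(** Sublevel sets at rational thresholds suffice: they are countably many, so almost every point is
    good for all of them at once, and a rational between two distinct values of [g] at good points
    contradicts [dense_ae_period_density]. *)
Lemma ae_period_ae_constant g a b : lebesgue_measurable_fun setT g ->
  a != 0 -> b != 0 -> ~ commensurable a b ->
  ae_period g a -> ae_period g b -> exists c, {ae mu, forall x, g x = c}.
Proof.
move=> mg a0 b0 ab ga gb.
(* An enumeration of the rationals; codes of no rational harmlessly repeat 0. *)
pose q (n : nat) : R := ratr (odflt 0 (pickle_inv n : option rat)).
have /choice[A HA] n : exists A : set R,
    measurable (A : set (measurableTypeR R)) /\
    {ae mu, forall x, (g x < q n) <-> A x}.
  have : lebesgue_measurable [set x | g x < q n].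
    have := mg measurableT `]-oo, q n[%classic (measurable_itv _).
    by rewrite setTI (_ : g @^-1` _ = [set x | g x < q n]).
  by move=> /lebesgue_measurableP[A mA gA]; exists A.
have Aper n : ae_period g `<=` ae_period (A n).
  move=> t gt; have gA := (HA n).2.
  apply: filterS3 gt gA (ae_shift t gA) => x gxt gA1 gA2.
  by apply/propext; rewrite -gA1 -gA2 gxt.
have Adense n (z r : R) : 0 < r -> exists2 s, ae_period (A n) s & `|z - s| < r.
  move=> r0; apply: (@subgroup_dense _ _ (@ae_periodB _ _ (A n)) a b) => //;
    exact: Aper.
have {ga gb} good :
    {ae mu, forall x n, near_density (A n) x /\ (g x < q n <-> A n x)}.
  apply: ae_foralln => n; have [mA gA] := HA n.
  by apply: filterS2 gA (ae_near_density mA).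
have le_good x y : (forall n, near_density (A n) x /\ (g x < q n <-> A n x)) ->
    (forall n, near_density (A n) y /\ (g y < q n <-> A n y)) -> g y <= g x.
  move=> gx gy; rewrite leNgt; apply/negP => /rat_in_itvoo[p].
  rewrite in_itv/= => /andP[xp py].
  have qp : q (pickle p) = ratr p by rewrite /q pickleK_inv.
  have [[dx [gAx _]] [dy [_ gAy]]] := (gx (pickle p), gy (pickle p)).
  rewrite qp in gAx gAy.
  have := gAy (dense_ae_period_density (HA _).1 (Adense _) dx dy (gAx xp)).
  by rewrite ltNge (ltW py).
have [x0 gx0] := ae_exists good.
exists (g x0); apply: filterS good => x gx.
by apply/eqP; rewrite eq_le !le_good.
Qed.

Lemma lebesgue_measurable_fun_shift f t : lebesgue_measurable_fun setT f ->
  lebesgue_measurable_fun setT (fun x => f (x + t)).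
Proof.
by move=> mf; exact: (measurableT_comp mf (measurable_lebesgue_shift t)).
Qed.

Lemma continuous_lebesgue_measurable_fun (u : R -> R) f : continuous u ->
  lebesgue_measurable_fun setT f -> lebesgue_measurable_fun setT (u \o f).
Proof.
by move=> /continuous_measurable_fun mu mf; exact: (measurableT_comp mu mf).
Qed.

(* If [c != 0] then [sin (pi * g / c)] and [cos (pi * g / c)] have the
   incommensurable periods [a] and [b *+ 2], so they are constant; since they are
   also antiperiodic with period [b], both vanish, which is absurd. *)
Lemma ae_constant_difference g a b c : lebesgue_measurable_fun setT g ->
  a != 0 -> b != 0 -> ~ commensurable a b -> ae_period g a ->
  {ae mu, forall x, g (x + b) - g x = c} ->
  exists d, {ae mu, forall x, g x = d}.
Proof.
move=> mg a0 b0 ab ga gb.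
have [c0|c0] := eqVneq c 0.
  apply: (ae_period_ae_constant mg a0 b0 ab ga).
  by apply: filterS gb => x /eqP; rewrite c0 subr_eq0 => /eqP.
have ab2 : ~ commensurable a (b *+ 2).
  move=> [_ _ [q abq]]; apply: ab; split=> //; exists (q * 2).
  by rewrite rmorphM/= -abq ratr_nat -[b *+ 2]mulr_natr; field.
have vanish (u : R -> R) : continuous u -> (forall y, u (y + pi) = - u y) ->
    {ae mu, forall x, u (pi * (g x / c)) = 0}.
  move=> cu upi; pose h x := u (pi * (g x / c)).
  have mh : lebesgue_measurable_fun setT h.
    apply: (@continuous_lebesgue_measurable_fun (fun y => u (pi * (y / c))))=> //.
    move=> y; apply: continuous_comp; last exact: cu.
    apply: cvgM; first exact: cvg_cst.
    by apply: cvgM; [exact: cvg_id|exact: cvg_cst].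
  have hb : {ae mu, forall x, h (x + b) = - h x}.
    apply: filterS gb => x gxb; rewrite /h -upi; congr u.
    by rewrite -[g (x + b)](subrK (g x)) gxb; field.
  have hb2 : ae_period h (b *+ 2).
    apply: filterS2 hb (ae_shift b hb) => x.
    by rewrite -addrA -mulr2n => -> ->; rewrite opprK.
  have ha : ae_period h a by apply: filterS ga => x gxa; rewrite /h gxa.
  have b20 : b *+ 2 != 0 by rewrite mulrn_eq0.
  have [k hk] := ae_period_ae_constant mh a0 b20 ab2 ha hb2.
  apply: filterS3 hk (ae_shift b hk) hb => x hx hxb hbx; apply/eqP.
  by rewrite -/(h x) -[_ == _](mulrn_eq0 _ 2) mulr2n {1}hx -hxb hbx addNr.
have [x []] : exists x, sin (pi * (g x / c)) = 0 /\ cos (pi * (g x / c)) = 0.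
  apply: ae_exists.
  have sin0 := vanish sin (@continuous_sin R) (@sinDpi R).
  have cos0 := vanish cos (@continuous_cos R) (@cosDpi R).
  by apply: filterS2 sin0 cos0.
move=> s0 c1; have /eqP := cos2Dsin2 (pi * (g x / c)).
by rewrite s0 c1 !expr0n/= addr0 eq_sym oner_eq0.
Qed.

End sum_of_periodic.

(** * Arithmetic of commensurable numbers *)

Section commensurability.
Context {R : realType}.
Implicit Types a b c : R.

Lemma commensurable_refl a : a != 0 -> commensurable a a.
Proof. by move=> a0; split=> //; exists 1; rewrite divff// rmorph1. Qed.

Lemma commensurable_sym a b : commensurable a b -> commensurable b a.
Proof.
move=> [a0 b0 [q abq]]; split=> //; exists q^-1.
by rewrite (fmorphV (@ratr R)) -[RHS]/((ratr q)^-1) -abq invf_div.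
Qed.

Lemma commensurable_trans a b c :
  commensurable a b -> commensurable b c -> commensurable a c.
Proof.
move=> [a0 b0 [q abq]] [_ c0 [r bcr]]; split=> //; exists (q * r).
by rewrite (rmorphM (@ratr R)) -[RHS]/(ratr q * ratr r) -abq -bcr mulrA divfK.
Qed.

Lemma commensurable_mulrz a (k : int) : a != 0 -> a *~ k != 0 ->
  commensurable (a *~ k) a.
Proof.
move=> a0 ak0; split=> //; exists k%:~R.
by rewrite ratr_int -mulrzl mulfK.
Qed.

(** If [T i = a * q i], then [a] times the numerator of [q i] is [T i] times its denominator. Hence
    [a] times the product of all numerators is a common multiple, up to sign. *)
Lemma commensurable_common_multiple (J : finType) (I : {set J}) (T : J -> R) a :
  a != 0 -> (forall i, i \in I -> commensurable (T i) a) ->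
  exists2 P, 0 < P & forall i, i \in I -> exists k : int, P = T i *~ k.
Proof.
move=> a0 Ta.
have /choice[q Tq] i : exists q : rat, i \in I -> q != 0 /\ T i = a * ratr q.
  have [iI|] := boolP (i \in I); last by exists 0.
  have [Ti0 _ [q Tq]] := Ta i iI; exists q => _; split.
    by apply: contra_neq Ti0 => q0; move: Tq; rewrite q0 rmorph0 => /eqP;
      rewrite mulf_eq0 invr_eq0 (negbTE a0) orbF => /eqP.
  by rewrite -Tq mulrC divfK.
pose m := \prod_(i in I) numq (q i).
have m0 : m != 0.
  by apply/prodf_neq0 => i iI; rewrite numq_eq0; have [] := Tq i iI.
have am0 : a *~ m != 0 by rewrite mulrz_eq0 negb_or m0.
have multiple i : i \in I -> exists k : int, a *~ m = T i *~ k.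
  move=> iI; have [_ Ti] := Tq i iI.
  exists (denq (q i) * \prod_(j in I | j != i) numq (q j)).
  rewrite /m (bigD1 i)//= !mulrzA; congr (_ *~ _).
  rewrite Ti -mulrzl -[RHS]mulrzl.
  have -> : (numq (q i))%:~R = (denq (q i))%:~R * ratr (q i) :> R.
    rewrite mulrC -[ratr _]/((numq (q i))%:~R / (denq (q i))%:~R).
    by rewrite divfK// intr_eq0 denq_neq0.
  by rewrite -mulrA [ratr _ * _]mulrC.
have [am|am|am] := ltgtP 0 (a *~ m); last by rewrite -am eqxx in am0.
  by exists (a *~ m).
exists (- (a *~ m)); first by rewrite oppr_gt0.
by move=> i /multiple[k ->]; exists (- k); rewrite mulrNz.
Qed.

End commensurability.

(** * Iterated differences *)

Section iterated_difference.
Context {R : realType}.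
Local Notation mu := (@lebesgue_measure R).
Implicit Types (f g h : R -> R) (s : seq R) (t P : R).

Definition difference g t : R -> R := fun x => g (x + t) - g x.

Definition iter_difference s g : R -> R := foldl difference g s.

Lemma difference_ae0 h t : {ae mu, forall x, h x = 0} ->
  {ae mu, forall x, difference h t x = 0}.
Proof.
move=> h0; apply: filterS2 h0 (ae_shift t h0) => x hx hxt.
by rewrite /difference hx hxt subrr.
Qed.

Lemma ae_period_difference g t P :
  ae_period g P -> ae_period (difference g t) P.
Proof.
move=> gP; apply: filterS2 gP (ae_shift t gP) => x gx gxt.
by rewrite /difference addrAC gx gxt.
Qed.

Lemma iter_difference_ae0 s h : {ae mu, forall x, h x = 0} ->
  {ae mu, forall x, iter_difference s h x = 0}.
Proof.
by elim: s h => //= t s IHs h h0; apply: IHs; exact: difference_ae0.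
Qed.

(** Differences taken before [P] keep the period, the one along [P] gives zero, and later ones keep
    zero. *)
Lemma iter_difference_ae_period s h P : P \in s -> ae_period h P ->
  {ae mu, forall x, iter_difference s h x = 0}.
Proof.
elim: s h => //= t s IHs h; rewrite inE => /predU1P[->|Ps] hP.
  apply: iter_difference_ae0; apply: filterS hP => x hx.
  by rewrite /difference hx subrr.
exact/IHs/ae_period_difference.
Qed.

Lemma iter_differenceB s g h :
  iter_difference s (g \- h) = iter_difference s g \- iter_difference s h.
Proof.
elim: s g h => //= t s IHs g h; rewrite -IHs; congr iter_difference.
by apply/funext => x; rewrite /difference/=; ring.
Qed.

Lemma iter_difference_sum s (J : finType) (I : {set J}) (F : J -> R -> R) :
  iter_difference s (fun x => \sum_(i in I) F i x) =
  fun x => \sum_(i in I) iter_difference s (F i) x.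
Proof.
elim: s F => //= t s IHs F; rewrite -(IHs (fun i => difference (F i) t)).
by congr iter_difference; apply/funext => x; rewrite /difference -sumrB.
Qed.

(** The induction yields only some constant value for [difference g t], possibly nonzero; this is
    the case that [ae_constant_difference] handles. *)
Lemma ae_constant_iter_difference s g P c : lebesgue_measurable_fun setT g ->
  P != 0 -> ae_period g P ->
  (forall t, t \in s -> t != 0 /\ ~ commensurable P t) ->
  {ae mu, forall x, iter_difference s g x = c} ->
  exists d, {ae mu, forall x, g x = d}.
Proof.
elim: s g c => [|t s IHs] /= g c mg P0 gP sP gc; first by exists c.
have [t0 Pt] := sP t (mem_head _ _).
have [||u us|d gd] := IHs (difference g t) c _ P0 _ _ gc.
- by apply: measurable_funB => //; exact: lebesgue_measurable_fun_shift.
- exact: ae_period_difference.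
- by apply: sP; rewrite inE us orbT.
exact: (ae_constant_difference mg P0 t0 Pt gP gd).
Qed.

Lemma ae_period_sum (J : finType) (I : pred J) (F : J -> R -> R) t :
  (forall i, I i -> ae_period (F i) t) ->
  ae_period (fun x => \sum_(i | I i) F i x) t.
Proof.
move=> Ft; have : {ae mu, forall x, forall i, I i -> F i (x + t) = F i x}.
  apply: filter_forall => i; case: (boolP (I i)) => [Ii|_]; last exact: nearW.
  by apply: filterS (Ft i Ii).
by apply: filterS => x Fx; exact: eq_bigr.
Qed.

Lemma lebesgue_measurable_fun_sum (J : finType) (I : {set J})
    (F : J -> R -> R) :
  (forall i, lebesgue_measurable_fun setT (F i)) ->
  lebesgue_measurable_fun setT (fun x => \sum_(i in I) F i x).
Proof.
move=> mF; have := measurable_sum (enum I) mF.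
by congr measurable_fun; apply/funext => x; rewrite big_enum.
Qed.

(* The differences along [t] and the [T i] incommensurable with [T i0] annihilate
   the sum of the other [F i], whose common period is incommensurable with
   all of them. *)
Lemma ae_constant_commensurable_class (J : finType) (F : J -> R -> R)
    (T : J -> R) (i0 : J) (t : R) :
  (forall i, lebesgue_measurable_fun setT (F i)) ->
  (forall i, T i != 0) -> (forall i, ae_period (F i) (T i)) ->
  t != 0 -> ae_period (fun x => \sum_i F i x) t -> ~ commensurable (T i0) t ->
  let I := finset.finset (fun i => `[< commensurable (T i) (T i0) >]) in
  exists c, {ae mu, forall x, \sum_(i in I) F i x = c}.
Proof.
move=> mF T0 FT t0 St Tt I.
have IP i : i \in I -> commensurable (T i) (T i0) by rewrite inE => /asboolP.
have [P P0 PI] := commensurable_common_multiple (T0 i0) IP.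
have i0I : i0 \in I by rewrite inE; apply/asboolP; exact: commensurable_refl.
have PT : commensurable P (T i0).
  have [k Pk] := PI i0 i0I; rewrite Pk; apply: commensurable_mulrz => //.
  by rewrite -Pk gt_eqF.
pose s := t :: [seq T i | i <- enum (finset.setC I)].
apply: (@ae_constant_iter_difference s _ P 0).
- exact: lebesgue_measurable_fun_sum.
- by rewrite gt_eqF.
- apply: ae_period_sum => i /PI[k ->].
  by apply: subgroup_mulrz => //; exact: ae_periodB.
- move=> u; rewrite inE => /predU1P[->|/mapP[i + ->]].
    split=> // Pt; apply: Tt; apply: commensurable_trans Pt.
    exact: commensurable_sym.
  rewrite mem_enum finset.in_setC inE => /asboolP iI; split=> // Pi; apply: iI.
  exact: commensurable_trans (commensurable_sym Pi) PT.
- have -> : (fun x => \sum_(i in I) F i x) =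
      (fun x => \sum_i F i x) \- (fun x => \sum_(i in finset.setC I) F i x).
    apply/funext => x /=; rewrite [in RHS](bigID (mem I))/=.
    under [X in _ - X]eq_bigl do rewrite finset.in_setC.
    by rewrite addrK.
  rewrite iter_differenceB iter_difference_sum.
  have S0 := @iter_difference_ae_period s _ t (mem_head _ _) St.
  have : {ae mu, forall x, forall i, i \in finset.setC I ->
      iter_difference s (F i) x = 0}.
    apply: filter_forall => i; have [iI|_] := boolP (i \in finset.setC I).
      have : T i \in s by rewrite inE map_f ?orbT// mem_enum.
      by move=> /iter_difference_ae_period /(_ (FT i)); apply: filterS.
    exact: nearW.
  apply: filterS2 S0 => x Sx Fx; rewrite /GRing.sub_fun Sx big1 ?subr0//.
Qed.

End iterated_difference.

(** * Passing from [D] to the whole line *)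

Section restriction.
Context {R : realType}.
Local Notation mu := (@lebesgue_measure R).
Implicit Types (D : set R) (f : R -> R) (t : R).

Lemma translation_invariantP D t :
  translation_invariant D t <-> forall x, D (x + t) <-> D x.
Proof.
split=> [DT x|DT].
  rewrite -{1}DT; split=> [[y Dy /addIr <-]//|Dx]; by exists x.
apply/seteqP; split=> [_ [x Dx <-]|x Dx]; first exact/DT.
by exists (x - t); rewrite ?subrK//; apply/DT; rewrite subrK.
Qed.

Lemma lebesgue_measurable_fun_restrict D f : lebesgue_measurable D ->
  lebesgue_measurable_fun D f -> lebesgue_measurable_fun setT (f \_ D).
Proof. by move=> mD mf; exact/(measurable_restrictT _ mD). Qed.

Lemma ae_period_restrict D f t : translation_invariant D t ->
  {ae mu, forall x, D x -> f (x + t) = f x} <-> ae_period (f \_ D) t.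
Proof.
move=> /translation_invariantP DT.
have inDT x : (x + t \in D) = (x \in D) by apply/idP/idP; rewrite !inE => /DT.
split; apply: filterS => x; rewrite !patchE inDT => fx.
- by case: ifPn => //; rewrite inE.
- by move=> Dx; move: fx; rewrite mem_set.
Qed.

Lemma ae_constant_restrict D f c : {ae mu, forall x, (f \_ D) x = c} ->
  ~ not_ae_constant D f.
Proof.
move=> fc /(_ c).
suff -> : completed_lebesgue_measure [set x | D x /\ f x <> c] = 0%E.
  by rewrite ltxx.
apply/negligible_outer_measure; apply: negligibleS fc => x /= [Dx].
by rewrite patchE mem_set.
Qed.

Lemma restrict_sum D (J : finType) (I : pred J) (F : J -> R -> R) :
  (fun x => \sum_(i | I i) F i x) \_ D = fun x => \sum_(i | I i) (F i \_ D) x.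
Proof.
apply/funext => x; rewrite patchE; case: ifPn => xD.
  by apply: eq_bigr => i _; rewrite patchE xD.
by rewrite big1// => i _; rewrite patchE (negbTE xD).
Qed.

End restriction.

Theorem theorem2 (R : realType) (n : nat) (hn : (0 < n)%N) (D : set R)
    (mD : lebesgue_measurable D) (D_gt0 : (0 < completed_lebesgue_measure D)%E)
    (f : 'I_n -> R -> R) (T : 'I_n -> R)
    (f_per : forall i, ae_periodic_with D (f i) (T i))
    (f_meas : forall i, lebesgue_measurable_fun D (f i))
    (f_nconst : forall i, not_ae_constant D (f i))
    (sum_nconst : forall I : {set 'I_n},
      I != finset.set0 -> I \proper finset.setT ->
      not_ae_constant D (fun x => \sum_(i in I) f i x)) :
  ae_periodic D (fun x => \sum_(i < n) f i x) <->
  (forall i j : 'I_n, commensurable (T i) (T j)).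
Proof.
have T0 i : T i != 0 by have [Ti _ _] := f_per i; rewrite gt_eqF.
pose F i := f i \_ D.
have mF i : lebesgue_measurable_fun setT (F i).
  exact: lebesgue_measurable_fun_restrict.
have FT i : ae_period (F i) (T i).
  have [_ DT /ae_completedE fT] := f_per i.
  exact/ae_period_restrict.
have sumF : (fun x => \sum_(i < n) f i x) \_ D = fun x => \sum_(i < n) F i x.
  exact: restrict_sum.
split=> [[t [t_gt0 Dt /ae_completedE]]|comm].
- move=> /(ae_period_restrict _ Dt); rewrite sumF => St.
  have t0 : t != 0 by rewrite gt_eqF.
  (* The commensurability class of [i] contains [i] but not [j], so [sum_nconst] applies to it. *)
  have not_comm i j : ~ commensurable (T i) (T j) -> commensurable (T i) t.
    move=> Tij; apply: contrapT => Tit.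
    have [c] := ae_constant_commensurable_class mF T0 FT t0 St Tit.
    set I := finset.finset _ => Sc.
    apply: (@ae_constant_restrict _ D (fun x => \sum_(i in I) f i x) c).
      by rewrite restrict_sum.
    apply: sum_nconst.
      apply/finset.set0Pn; exists i; rewrite inE; apply/asboolP.
      exact: commensurable_refl.
    rewrite finset.properEneq finset.subsetT andbT; apply/eqP => IT.
    have : j \in I by rewrite IT inE.
    by rewrite inE => /asboolP /commensurable_sym.
  (* Both periods would be commensurable with [t], hence with each other. *)
  move=> i j; apply: contrapT => Tij; apply: (Tij).
  apply: commensurable_trans (not_comm _ _ Tij) _; apply/commensurable_sym.
  by apply: (not_comm j i) => /commensurable_sym.
(* Conversely, a common multiple of all the [T i] is a period of the sum; [T i0] serves as the
   reference period. *)
- pose i0 := Ordinal hn.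
  have [P P0 PT] := @commensurable_common_multiple _ _ finset.setT T _ (T0 i0)
    (fun i _ => comm i i0).
  exists P; have DP : translation_invariant D P.
    have [k ->] := PT i0 (finset.in_setT _); apply/translation_invariantP.
    have [_ /translation_invariantP DT _] := f_per i0.
    (* The translations preserving [D] form a group, so [D] is invariant under multiples of
       [T i0]. *)
    apply: (@subgroup_mulrz _ [set t | forall x, D (x + t) <-> D x]) => //.
    move=> s t Ds Dt x; rewrite addrA -(Dt (x + s - t)) subrK; exact: Ds.
  split=> //; apply/ae_completedE/(ae_period_restrict _ DP); rewrite sumF.
  apply: ae_period_sum => i _; have [k ->] := PT i (finset.in_setT _).
  by apply: subgroup_mulrz => //; exact: ae_periodB.
Qed.
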